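(* Let $(\mathcal{A},\varphi)$ be an algebraic noncommutative probability space, let $a\in\mathcal{A}$ be such that $\varphi(a)=1$, and consider the reciprocal $S$-transform $1/S_a(z)=\sum_{n=0}^{\infty}t_nz^n$. Then for every $n\ge 1$ one has $$\varphi(a^n)=\sum_{\substack{\alpha,\beta\in NC(n)\\ \text{such that }\alpha\ll\beta}}\Bigl(\prod_{U\in\alpha,\ U\ \beta\text{-special}}t_{|U|-1}\Bigr)\cdot\Bigl(\prod_{V\in\alpha,\ V\text{ not }\beta\text{-special}}t_{|V|}\Bigr).$$
   Context: An algebraic noncommutative probability space $(\mathcal{A},\varphi)$ consists of a unital algebra $\mathcal{A}$ over $\mathbb{C}$ and a linear functional $\varphi:\mathcal{A}\to\mathbb{C}$ with $\varphi(1_{\mathcal{A}})=1$. For $a\in\mathcal{A}$ with $\varphi(a)=1$, the moment series is the formal power series $M_a(z):=\sum_{n=1}^{\infty}\varphi(a^n)z^n$, and the $S$-transform of $a$ is the series $S_a(z):=\frac{1+z}{z}M_a^{\langle -1\rangle}(z)\in\mathbb{C}[[z]]$, where $M_a^{\langle -1\rangle}$ is the inverse of $M_a$ under composition. $S_a$ has constant term $1$, and $1/S_a(z)=\sum_{n=0}^\infty t_nz^n$ denotes its inverse under multiplication (so $t_0=1$). $NC(n)$ denotes the set of non-crossing partitions of $\{1,\ldots,n\}$, and $V\in\alpha$ means that $V$ is a block of $\alpha$. For $\alpha,\beta\in NC(n)$, $\alpha\le\beta$ means that every block of $\beta$ is a union of blocks of $\alpha$; and $\alpha\ll\beta$ means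 that $\alpha\le\beta$ and, in addition, for every block $W$ of $\beta$ there exists a block $V$ of $\alpha$ such that $\min(W),\max(W)\in V$. When $\alpha\ll\beta$, a block $V$ of $\alpha$ is called $\beta$-special if there exists a block $W$ of $\beta$ such that $\min(V)=\min(W)$ and $\max(V)=\max(W)$. *)

(* Defs.v *)
From mathcomp Require Import all_boot all_order all_algebra.
From mathcomp Require Import reals complex.

Set Implicit Arguments.
Unset Strict Implicit.
Unset Printing Implicit Defensive.

Import GRing.Theory.
Local Open Scope ring_scope.

Section FormalPowerSeries.
Variable K : fieldType.

(* [f n] is the coefficient of [z^n]. *)
Definition fps := nat -> K.
Implicit Types f g h : fps.

Definition fps_one : fps := fun n => (n == 0%N)%:R.
Definition fps_X : fps := fun n => (n == 1%N)%:R.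
Definition fps_add f g : fps := fun n => f n + g n.
Definition fps_mul f g : fps := fun n => \sum_(i < n.+1) f i * g (n - i)%N.
Definition fps_exp f k : fps := iter k (fps_mul f) fps_one.

(* [f / z], for a series [f] without constant term. *)
Definition fps_divX f : fps := fun n => f n.+1.

(* The composite [f (g (z))], for [g] without constant term: then [g ^ k] has
   no term of degree [< k], so that the terms with [k > n] do not contribute
   to the coefficient of [z^n]. *)
Definition fps_comp f g : fps := fun n => \sum_(k < n.+1) f k * fps_exp g k n.

(* Coefficient by coefficient solution of [Phi g = h], where [Phi] is such that
   adding [c z^n] to a series adds [b c] to the coefficient of [z^n] in its
   image and leaves the lower ones unchanged.  [fps_solve_below Phi b h n] is
   the solution truncated to the degrees [< n]. *)
Fixpoint fps_solve_below (Phi : fps -> fps) (b : K) h n : fps :=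
  if n is m.+1 then
    let g := fps_solve_below Phi b h m in
    fun k => if k == m then (h m - Phi g m) / b else g k
  else fun=> 0.

Definition fps_solve Phi b h : fps := fun n => fps_solve_below Phi b h n.+1 n.

(* Multiplicative inverse, meaningful for [f 0 != 0]; see [fps_mulV]. *)
Definition fps_inv f : fps := fps_solve (fps_mul f) (f 0%N) fps_one.

(* Compositional inverse, meaningful for [f 0 = 0] and [f 1 != 0]; see
   [fps_compV] and [fps_cinv_uniq]. *)
Definition fps_cinv f : fps := fps_solve (fps_comp f) (f 1%N) fps_X.

Lemma fps_solve_belowE Phi b h n k :
  fps_solve_below Phi b h n k = if (k < n)%N then fps_solve Phi b h k else 0.
Proof.
elim: n => [|n IHn] //=; rewrite ltnS leq_eqVlt.
by case: eqP => [->|_]; rewrite ?IHn // /fps_solve /= eqxx.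
Qed.

Lemma fps_solveE Phi b h n : b != 0 ->
  b * fps_solve Phi b h n = h n - Phi (fps_solve_below Phi b h n) n.
Proof. by move=> b0; rewrite /fps_solve /= eqxx mulrC divfK. Qed.

Lemma fps_mul_split f g g' n : (forall k, (k < n)%N -> g k = g' k) ->
  fps_mul f g n - fps_mul f g' n = f 0%N * (g n - g' n).
Proof.
move=> gg'; rewrite /fps_mul !big_ord_recl !subn0 opprD addrACA -mulrBr.
rewrite [X in _ + X](_ : _ = 0) ?addr0 //; apply/eqP; rewrite subr_eq0.
apply/eqP/eq_bigr => i _; rewrite gg' //= /bump leq0n.
by have ni := ltn_ord i; rewrite ltn_subrL (leq_ltn_trans _ ni).
Qed.

Theorem fps_mulV f : f 0%N != 0 -> fps_mul f (fps_inv f) =1 fps_one.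
Proof.
move=> f0 n; set g' := fps_solve_below (fps_mul f) (f 0%N) fps_one n.
have gg' k : (k < n)%N -> fps_inv f k = g' k.
  by move=> kn; rewrite /g' fps_solve_belowE kn.
have := fps_mul_split f gg'.
rewrite [g' n]fps_solve_belowE ltnn subr0 fps_solveE // -/g'.
by move/addIr.
Qed.

Lemma fps_expS f k : fps_exp f k.+1 = fps_mul f (fps_exp f k).
Proof. by []. Qed.

Lemma fps_exp0 g k : g 0%N = 0 -> fps_exp g k.+1 0%N = 0.
Proof. by move=> g0; rewrite /= /fps_mul big_ord1 g0 mul0r. Qed.

Lemma fps_exp1 g n : fps_exp g 1 n = g n.
Proof.
rewrite /= /fps_mul big_ord_recr /= subnn mulr1 big1 ?add0r // => i _.
by rewrite /fps_one subn_eq0 leqNgt ltn_ord mulr0.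
Qed.

Lemma fps_exp_local g g' k n : (forall i, (i <= n)%N -> g i = g' i) ->
  fps_exp g k n = fps_exp g' k n.
Proof.
elim: k n => // k IHk n gg' /=; apply: eq_bigr => i _.
rewrite gg' -1?ltnS // (IHk (n - i)%N) // => j jn; apply: gg'.
exact: leq_trans jn (leq_subr _ _).
Qed.

Lemma fps_comp_split f g g' n : g 0%N = 0 -> g' 0%N = 0 -> (0 < n)%N ->
  (forall k, (k < n)%N -> g k = g' k) ->
  fps_comp f g n - fps_comp f g' n = f 1%N * (g n - g' n).
Proof.
case: n => // n g0 g'0 _ gg'; rewrite /fps_comp !big_ord_recl !fps_exp1.
rewrite opprD addrACA subrr add0r opprD addrACA -mulrBr.
rewrite [X in _ + X](_ : _ = 0) ?addr0 //; apply/eqP; rewrite subr_eq0.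
apply/eqP/eq_bigr => k _; congr (_ * _); rewrite !lift0 !(fps_expS _ k.+1).
apply: eq_bigr => i _; have [-> | i0] := posnP i; first by rewrite g0 g'0 !mul0r.
have [in1 | ni] := ltnP i n.+1; last first.
  have /eqP -> : (n.+1 - i == 0)%N by rewrite subn_eq0.
  by rewrite !fps_exp0 // !mulr0.
rewrite gg' //; congr (_ * _); apply: fps_exp_local => j jn; apply: gg'.
by apply: leq_ltn_trans jn _; rewrite ltn_subrL i0.
Qed.

Lemma fps_cinv0 f : f 0%N = 0 -> fps_cinv f 0%N = 0.
Proof.
by move=> f0; rewrite /fps_cinv /fps_solve /= /fps_comp big_ord1 f0 mul0r subr0 mul0r.
Qed.

Theorem fps_compV f : f 0%N = 0 -> f 1%N != 0 ->
  fps_comp f (fps_cinv f) =1 fps_X.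
Proof.
move=> f0 f1 [|n]; first by rewrite /fps_comp big_ord1 f0 mul0r.
set g' := fps_solve_below (fps_comp f) (f 1%N) fps_X n.+1.
have gg' k : (k < n.+1)%N -> fps_cinv f k = g' k.
  by move=> kn; rewrite /g' fps_solve_belowE kn.
have c0 := fps_cinv0 f0.
have := @fps_comp_split f _ g' n.+1 c0 _ isT gg'; rewrite -gg' // => /(_ c0).
rewrite [g' n.+1]fps_solve_belowE ltnn subr0 fps_solveE // -/g'.
by move/addIr.
Qed.

Theorem fps_cinv_uniq f g : f 0%N = 0 -> f 1%N != 0 -> g 0%N = 0 ->
  fps_comp f g =1 fps_X -> g =1 fps_cinv f.
Proof.
move=> f0 f1 g0 fg n; have c0 := fps_cinv0 f0.
elim/ltn_ind: n => -[|n] IHn; first by rewrite g0 c0.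
have := fps_comp_split f g0 c0 (ltn0Sn n) IHn.
rewrite fg fps_compV // subrr => /esym/eqP.
by rewrite mulf_eq0 (negPf f1) subr_eq0 => /eqP.
Qed.

End FormalPowerSeries.

Section STransform.
Context (K : fieldType) (A : algType K) (phi : {scalar A}).

Definition moment_series (a : A) : fps K :=
  fun n => if n is 0 then 0 else phi (a ^+ n).

Definition S_transform (a : A) : fps K :=
  fps_divX (fps_mul (fps_add (fps_one K) (fps_X K)) (fps_cinv (moment_series a))).

Lemma S_transform0 a : phi a = 1 -> S_transform a 0%N = 1.
Proof.
move=> pa; have M0 : moment_series a 0%N = 0 by [].
have M1 : moment_series a 1%N = 1 by rewrite /= expr1.
have c0 := fps_cinv0 M0.
have := @fps_compV _ _ M0; rewrite M1 oner_neq0 => /(_ isT 1%N).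
rewrite /fps_comp 2!big_ord_recr big_ord0 fps_exp1 /= mul0r !add0r expr1 pa mul1r
  => c1.
rewrite /S_transform /fps_divX /fps_mul 2!big_ord_recr big_ord0 /= subn0 subnn.
by rewrite c0 c1 mulr0 add0r addr0 /fps_add /fps_one /fps_X /= addr0 mulr1.
Qed.

End STransform.

(* The ground set [{1, ..., n}] is represented by ['I_n], i.e. by
   [{0, ..., n - 1}] with its natural order. *)

Section NonCrossing.
Variable n : nat.
Implicit Types (V W : {set 'I_n}) (alpha beta : {set {set 'I_n}}).

Definition noncrossing alpha : bool :=
  [forall V in alpha, forall W in alpha,
    [exists i : 'I_n, exists j : 'I_n, exists k : 'I_n, exists l : 'I_n,
      [&& (i < j)%N, (j < k)%N, (k < l)%N,
          i \in V, k \in V, j \in W & l \in W]] ==> (V == W)].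

Definition NC : {set {set {set 'I_n}}} :=
  [set alpha | partition alpha [set: 'I_n] & noncrossing alpha].

Definition refines alpha beta : bool :=
  [forall W in beta, exists S : {set {set 'I_n}},
    (S \subset alpha) && (W == cover S)].

Definition is_min (i : 'I_n) V : bool := (i \in V) && [forall j in V, (i <= j)%N].
Definition is_max (i : 'I_n) V : bool := (i \in V) && [forall j in V, (j <= i)%N].

Definition ll alpha beta : bool :=
  refines alpha beta &&
  [forall W in beta, exists V in alpha,
    [exists i, exists j, [&& is_min i W, is_max j W, i \in V & j \in V]]].

Definition special beta V : bool :=
  [exists W in beta,
    [exists i, is_min i V && is_min i W] && [exists j, is_max j V && is_max j W]].

End NonCrossing.

(* Main.v *)
Require Import Defs.
From mathcomp Require Import all_boot all_order all_algebra.
From mathcomp Require Import boolp reals complex zify.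

(** Write [M] for the moment series, [chi] for its compositional inverse, [S]
for the S-transform and [t] for [1 / S]. By definition [z S = (1 + z) chi]. Let
[C] be the compositional inverse of [z S]; it is the generating series of the
free cumulants of [a]. Two functional equations follow from the definitions
alone.
 - [C = z (t o C)], because [C (S o C) = z] ([R_transform_fixpoint]).
 - [1 + M = (1 + C) o (z (1 + M))], because [z S] composed with [M] is
   [z (1 + M)] and [C] is the inverse of [z S] ([moment_cumulant]).

Both are instances of the equation [g = f o (z g)], whose solution counts
non-crossing partitions: if [f 0 = 1], then the coefficient [g n] is the sum,
over the non-crossing partitions of [n] points, of the product over the blocks
[V] of the weights [f |V|] ([noncrossing_functional_equation], [sum_NCon]).
Indeed, let [m] be the last element of the block that contains the first point.
The points after [m] carry an arbitrary non-crossing partition, and on the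
points up to [m] the first and the last are in the same block. Removing [m] from
this block leaves an arbitrary non-crossing partition of the points before [m],
in which the first block weighs one more element than it has. This recursion is
the one that computes the coefficients of a composite with [z g].

The second equation thus gives [phi (a ^+ n)] as the sum over [beta] of
[\prod_(W in beta) C |W|]. It remains to expand each [C |W|]. A partition
[alpha] with [ll alpha beta] amounts to a choice, for every block [W] of
[beta], of a non-crossing partition of [W] that joins the minimum and the
maximum of [W] ([factorization], [llE]), and the block joining them is the only
special one inside [W] ([special_closed]). With weight [t (k - 1)] on it and
[t k] on the other blocks, removing the maximum of [W] gives the sum over all
the non-crossing partitions of [|W| - 1] points with weights [t k]. By the first
equation this is the coefficient of degree [|W| - 1] of [C / z], that is
[C |W|] ([sum_closed]). *)

Set Implicit Arguments.
Unset Strict Implicit.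
Unset Printing Implicit Defensive.

Import GRing.Theory.
Local Open Scope ring_scope.

(** * Composition of formal power series *)

Section Series.
Variable K : fieldType.
Implicit Types (f g h : fps K) (p q : {poly K}).

(** The ring and composition laws of series are read off those of polynomials:
a coefficient of a product or composite of series depends only on finitely many
coefficients, so it may be computed on truncations. *)
Definition approx n p f := forall i, (i <= n)%N -> p`_i = f i.

Lemma approx_poly n f : approx n (\poly_(i < n.+1) f i) f.
Proof. by move=> i le_in; rewrite coef_poly ltnS le_in. Qed.
Arguments approx_poly n f : clear implicits.

Lemma approx_mul n p q f g :
  approx n p f -> approx n q g -> approx n (p * q) (fps_mul f g).
Proof.
move=> pf qg i le_in; rewrite coefM; apply: eq_bigr => j _.
rewrite pf ?qg //; first exact: leq_trans (leq_subr _ _) le_in.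
by apply: leq_trans le_in; rewrite -ltnS.
Qed.

Lemma approx_exp n q g k : approx n q g -> approx n (q ^+ k) (fps_exp g k).
Proof.
move=> qg; elim: k => [|k IHk]; first by move=> i _; rewrite coef1.
by rewrite exprS; apply: approx_mul.
Qed.

Lemma fps_exp_lt g k n : g 0%N = 0 -> (n < k)%N -> fps_exp g k n = 0.
Proof.
move=> g0; elim: k n => // k IHk n lt_nk; rewrite fps_expS.
apply: big1 => -[[|i] /= lt_in] _; first by rewrite g0 mul0r.
by rewrite IHk ?mulr0 //; lia.
Qed.

(** The sum defining the composite stops at the degree of the coefficient, the
one for polynomials at the size of [p]. The terms that are in only one of them
vanish, as [g ^ k] has no term of degree less than [k]. *)
Lemma approx_comp n p q f g : g 0%N = 0 ->
  approx n p f -> approx n q g -> approx n (p \Po q) (fps_comp f g).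
Proof.
move=> g0 pf qg i le_in; rewrite coef_comp_poly.
(* Both sums are extended by zeros to a common range. *)
set N := (size p + i.+1)%N.
transitivity (\sum_(k < N) p`_k * fps_exp g k i).
  rewrite (big_ord_widen N (fun k => p`_k * (q ^+ k)`_i)) ?leq_addr //.
  rewrite big_mkcond; apply: eq_bigr => k _.
  rewrite (approx_exp k qg) //; case: ltnP => // le_pk.
  by rewrite nth_default ?mul0r.
rewrite /fps_comp (big_ord_widen N (fun k => f k * fps_exp g k i)) ?leq_addl //.
rewrite [RHS]big_mkcond; apply: eq_bigr => k _; rewrite ltnS.
case: leqP => [le_ki|lt_ik]; first by rewrite pf // (leq_trans le_ki).
by rewrite fps_exp_lt ?mulr0.
Qed.

Lemma fps_mulC f g : fps_mul f g = fps_mul g f.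
Proof.
apply: funext => n; have fn := approx_poly n f; have gn := approx_poly n g.
by rewrite -(approx_mul fn gn) // mulrC (approx_mul gn fn).
Qed.

Lemma fps_mulA f g h : fps_mul f (fps_mul g h) = fps_mul (fps_mul f g) h.
Proof.
apply: funext => n; have fn := approx_poly n f; have gn := approx_poly n g.
have hn := approx_poly n h.
rewrite -(approx_mul fn (approx_mul gn hn)) // mulrA.
by rewrite (approx_mul (approx_mul fn gn) hn).
Qed.

Lemma fps_mulf1 f : fps_mul f (fps_one K) = f.
Proof. by apply: funext => n; apply: fps_exp1. Qed.

Lemma fps_mulX0 f : fps_mul (fps_X K) f 0%N = 0.
Proof. by rewrite /fps_mul big_ord1 mul0r. Qed.

Lemma fps_mulXS f n : fps_mul (fps_X K) f n.+1 = f n.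
Proof.
rewrite /fps_mul 2!big_ord_recl mul0r add0r mul1r big1 ?addr0 ?subSS ?subn0 //.
by move=> i _; rewrite mul0r.
Qed.

Lemma fps_mulX_divX f : f 0%N = 0 -> fps_mul (fps_X K) (fps_divX f) = f.
Proof. by move=> f0; apply: funext => -[|n]; rewrite ?fps_mulX0 ?fps_mulXS. Qed.

Lemma fps_divX_mulX f : fps_divX (fps_mul (fps_X K) f) = f.
Proof. by apply: funext => n; rewrite /fps_divX fps_mulXS. Qed.

Lemma fps_comp0 f g : fps_comp f g 0%N = f 0%N.
Proof. by rewrite /fps_comp big_ord1 /= /fps_one mulr1. Qed.

Lemma fps_compD f g h :
  fps_comp (fps_add f g) h = fps_add (fps_comp f h) (fps_comp g h).
Proof.
apply: funext => n; rewrite /fps_comp /fps_add -big_split /=.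
by apply: eq_bigr => i _; rewrite mulrDl.
Qed.

Lemma fps_comp1 g : fps_comp (fps_one K) g = fps_one K.
Proof.
apply: funext => n; rewrite /fps_comp big_ord_recl /= mul1r big1 ?addr0 //.
by move=> i _; rewrite mul0r.
Qed.

Lemma fps_compX g : g 0%N = 0 -> fps_comp (fps_X K) g = g.
Proof.
move=> g0; apply: funext => -[|n]; first by rewrite fps_comp0 g0.
rewrite /fps_comp 2!big_ord_recl mul0r add0r mul1r fps_exp1 big1 ?addr0 //.
by move=> i _; rewrite mul0r.
Qed.

Lemma fps_compM f g h : h 0%N = 0 ->
  fps_comp (fps_mul f g) h = fps_mul (fps_comp f h) (fps_comp g h).
Proof.
move=> h0; apply: funext => n; have fn := approx_poly n f.
have gn := approx_poly n g; have hn := approx_poly n h.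
rewrite -(approx_comp h0 (approx_mul fn gn) hn) // comp_polyM.
by rewrite (approx_mul (approx_comp h0 fn hn) (approx_comp h0 gn hn)).
Qed.

Lemma fps_compA f g h : g 0%N = 0 -> h 0%N = 0 ->
  fps_comp f (fps_comp g h) = fps_comp (fps_comp f g) h.
Proof.
move=> g0 h0; apply: funext => n; have fn := approx_poly n f.
have gn := approx_poly n g; have hn := approx_poly n h.
have gh0 : fps_comp g h 0%N = 0 by rewrite fps_comp0.
rewrite -(approx_comp gh0 fn (approx_comp h0 gn hn)) // comp_polyA.
by rewrite (approx_comp h0 (approx_comp g0 fn gn) hn).
Qed.

Lemma fps_compfX f : fps_comp f (fps_X K) = f.
Proof.
apply: funext => n; have fn := approx_poly n f.
have Xn : approx n 'X (fps_X K) by move=> i _; rewrite coefX.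
by rewrite -(approx_comp _ fn Xn) // comp_polyXr fn.
Qed.

(** The coefficients of [f o (z g)] by recursion on the degree, from
[f = f 0 + z (divX f)]. Non-crossing partitions obey the same recursion. *)
Lemma fps_compXmulS f g n :
  fps_comp f (fps_mul (fps_X K) g) n.+1 =
  fps_mul (fps_comp (fps_divX f) (fps_mul (fps_X K) g)) g n.
Proof.
set u := fps_mul _ g; have u0 : u 0%N = 0 by apply: fps_mulX0.
have fE : f = fps_add (fun k => f 0%N * fps_one K k)
                      (fps_mul (fps_X K) (fps_divX f)).
  apply: funext => -[|k]; rewrite /fps_add ?fps_mulX0 ?fps_mulXS /fps_one /=.
    by rewrite mulr1 addr0.
  by rewrite mulr0 add0r.
rewrite {1}fE fps_compD fps_compM // fps_compX // /fps_add -fps_mulA fps_mulXS.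
rewrite [X in X + _](_ : _ = 0) ?add0r 1?fps_mulC //.
rewrite /fps_comp big_ord_recl /= mulr0 big1 ?addr0 //.
by move=> i _; rewrite mulr0 mul0r.
Qed.

(** If [f o g = z] and [c] is the right inverse of [g], then
[f = f o g o c = c]. *)
Lemma fps_comp_leftV f g : f 0%N = 0 -> g 0%N = 0 -> g 1%N != 0 ->
  fps_comp f g = fps_X K -> fps_comp g f = fps_X K.
Proof.
move=> f0 g0 g1 fg; have c0 := fps_cinv0 g0.
have gc : fps_comp g (fps_cinv g) = fps_X K by apply/funext/fps_compV.
suff -> : f = fps_cinv g by [].
by rewrite -[f in LHS]fps_compfX -gc fps_compA // fg fps_compX.
Qed.

End Series.

(** * Functional equations for moments and free cumulants *)

Section Functional.
Context (K : fieldType) (A : algType K) (phi : {scalar A}) (a : A).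
Hypothesis phia : phi a = 1.

Let M := moment_series phi a.
Let S := S_transform phi a.
Let t := fps_inv S.

(** Its coefficients are the free cumulants of [a], by [moment_cumulant]. *)
Definition R_transform : fps K := fps_cinv (fps_mul (fps_X K) S).
Let C := R_transform.

Let S0 : S 0%N = 1. Proof. exact: S_transform0. Qed.

Lemma S_transformE :
  fps_mul (fps_X K) S =
  fps_mul (fps_add (fps_one K) (fps_X K)) (fps_cinv M).
Proof.
by apply: fps_mulX_divX; rewrite /fps_mul big_ord1 fps_cinv0 ?mulr0.
Qed.

Lemma R_transform0 : C 0%N = 0.
Proof. exact/fps_cinv0/fps_mulX0. Qed.

Lemma XS_comp_R_transform : fps_comp (fps_mul (fps_X K) S) C = fps_X K.
Proof.
apply/funext/fps_compV; first exact: fps_mulX0.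
by rewrite fps_mulXS S0 oner_neq0.
Qed.

Lemma mul_S_t : fps_mul S t = fps_one K.
Proof. by apply/funext/fps_mulV; rewrite S0 oner_neq0. Qed.

Lemma inv_S_transform0 : t 0%N = 1.
Proof.
have := congr1 (fun f => f 0%N) mul_S_t.
by rewrite /fps_mul big_ord1 S0 mul1r.
Qed.

(** With [q = C / z], this is [q = t o (z q)]: compose [z S] with [C] and
multiply the result by [t o C]. *)
Lemma R_transform_fixpoint :
  fps_divX C = fps_comp t (fps_mul (fps_X K) (fps_divX C)).
Proof.
rewrite fps_mulX_divX ?R_transform0 //.
suff CE : C = fps_mul (fps_X K) (fps_comp t C) by rewrite {1}CE fps_divX_mulX.
rewrite -{1}XS_comp_R_transform fps_compM ?R_transform0 // fps_compX ?R_transform0 //.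
by rewrite -fps_mulA -fps_compM ?R_transform0 // mul_S_t fps_comp1 fps_mulf1.
Qed.

(** Speicher's moment-cumulant relation. Composing [z S = (1 + z) chi] with [M]
gives [(1 + M) z], and [C] undoes [z S]. *)
Lemma moment_cumulant :
  fps_add (fps_one K) M =
  fps_comp (fps_add (fps_one K) C)
           (fps_mul (fps_X K) (fps_add (fps_one K) M)).
Proof.
have M0 : M 0%N = 0 by [].
have M1 : M 1%N != 0 by rewrite /M /= expr1 phia oner_neq0.
have chi0 := fps_cinv0 M0.
have chi1 : fps_cinv M 1%N = 1.
  have := congr1 (fun f => f 1%N) S_transformE; rewrite fps_mulXS S0.
  rewrite /fps_mul !big_ord_recr big_ord0 /= subnn chi0 mulr0 addr0 add0r.
  by rewrite /fps_add /fps_one /fps_X /= addr0 mul1r.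
have chiM : fps_comp (fps_cinv M) M = fps_X K.
  by apply: fps_comp_leftV; rewrite ?chi1 ?oner_neq0 //; apply/funext/fps_compV.
have P0 := fps_mulX0 S.
have CP : fps_comp C (fps_mul (fps_X K) S) = fps_X K.
  apply: fps_comp_leftV; rewrite ?R_transform0 //; last exact: XS_comp_R_transform.
  have := congr1 (fun f => f 0%N) R_transform_fixpoint; rewrite {1}/fps_divX => ->.
  by rewrite fps_comp0 inv_S_transform0 oner_neq0.
rewrite fps_compD fps_comp1; congr fps_add.
transitivity (fps_comp (fps_comp C (fps_mul (fps_X K) S)) M).
  by rewrite CP fps_compX.
rewrite -fps_compA //; congr fps_comp.
by rewrite S_transformE fps_compM // fps_compD fps_comp1 fps_compX // chiM fps_mulC.
Qed.

End Functional.

(** * Non-crossing partitions of a subset *)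

Section Partitions.
Variable n : nat.
Implicit Types (V W D : {set 'I_n}) (alpha beta : {set {set 'I_n}}) (i j k l x y : 'I_n).

Lemma noncrossingP alpha :
  reflect (forall V W i j k l, V \in alpha -> W \in alpha ->
             (i < j)%N -> (j < k)%N -> (k < l)%N ->
             i \in V -> k \in V -> j \in W -> l \in W -> V = W)
          (noncrossing alpha).
Proof.
apply: (iffP forall_inP) => [nc V W i j k l aV aW ij jk kl iV kV jW lW | nc V aV].
  have /forall_inP/(_ W aW)/implyP vw := nc V aV; apply/eqP/vw.
  apply/existsP; exists i; apply/existsP; exists j.
  apply/existsP; exists k; apply/existsP; exists l.
  by rewrite ij jk kl iV kV jW.
apply/forall_inP => W aW; apply/implyP.
case/existsP=> i /existsP[j /existsP[k /existsP[l]]].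
case/and5P=> ij jk kl iV /and3P[kV jW lW].
by apply/eqP; apply: (nc V W i j k l).
Qed.

Definition blocks alpha D :=
  [/\ forall V, V \in alpha -> V \subset D,
      forall V, V \in alpha -> exists x, x \in V,
      forall x, x \in D -> exists2 V, V \in alpha & x \in V
    & forall V W x, V \in alpha -> W \in alpha -> x \in V -> x \in W -> V = W].

Lemma blocksP alpha D : reflect (blocks alpha D) (partition alpha D).
Proof.
apply: (iffP and3P) => [[/eqP<- tI n0] | [sub ne cov tI]].
  split=> [V aV | V aV | x /bigcupP[V aV xV] | V W x aV aW xV xW].
  - exact: bigcup_sup.
  - by apply/set0Pn; apply: contraNneq n0 => <-.
  - by exists V.
  by rewrite -(def_pblock tI aV xV) (def_pblock tI aW xW).
split.
- apply/eqP/setP=> x; apply/bigcupP/idP => [[V aV xV] | /cov[V aV xV]].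
    exact: (subsetP (sub V aV)).
  by exists V.
- apply/trivIsetP=> V W aV aW; apply: contraNT => /pred0Pn[x /andP[xV xW]].
  exact/eqP/(tI V W x).
by apply/negP => /ne[x]; rewrite inE.
Qed.

(** The ground set is any subset [D] of the points, so that partitions may be cut
into pieces without relabelling the points. *)
Definition NCon D := [set alpha | partition alpha D & noncrossing alpha].

Lemma NConP alpha D :
  reflect (blocks alpha D /\ noncrossing alpha) (alpha \in NCon D).
Proof. by rewrite inE; apply: (iffP andP) => -[/blocksP ? ?]. Qed.

Lemma NCon_setT : NCon [set: 'I_n] = NC n. Proof. by []. Qed.

Definition blocks_in alpha W := [set V in alpha | V \subset W].

Lemma noncrossing_sub alpha beta :
  alpha \subset beta -> noncrossing beta -> noncrossing alpha.
Proof.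
move=> /subsetP ab /noncrossingP nc; apply/noncrossingP.
by move=> V W i j k l /ab bV /ab bW; apply: nc.
Qed.

Lemma noncrossing_blocks_in alpha W :
  noncrossing alpha -> noncrossing (blocks_in alpha W).
Proof. by apply: noncrossing_sub; apply/subsetP => V; rewrite inE => /andP[]. Qed.

Lemma blocks_in_NCon alpha D W : alpha \in NCon D -> W \subset D ->
  (forall V x y, V \in alpha -> x \in V -> y \in V -> x \in W -> y \in W) ->
  blocks_in alpha W \in NCon W.
Proof.
move=> /NConP[[sub ne cov tI] nc] /subsetP WD stable.
apply/NConP; split; last exact: noncrossing_blocks_in.
split=> [V | V | x xW | V V' x].
- by rewrite inE => /andP[].
- by rewrite inE => /andP[/ne+ _].
- have [V aV xV] := cov _ (WD x xW); exists V => //; rewrite inE aV.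
  by apply/subsetP => y yV; apply: (stable V x).
by rewrite !inE => /andP[aV _] /andP[aV' _]; apply: tI.
Qed.

(** If the blocks of [alpha] inside [W] cover [W], then every block of [alpha]
that meets [W] is one of them. *)
Lemma blocks_in_stable alpha D W : alpha \in NCon D -> blocks_in alpha W \in NCon W ->
  forall V x, V \in alpha -> x \in V -> x \in W -> V \subset W.
Proof.
move=> /NConP[[sub ne cov tI] _] /NConP[[_ _ covW _] _] V x aV xV xW.
have [V'] := covW x xW; rewrite inE => /andP[aV' V'W] xV'.
by rewrite (tI V V' x).
Qed.

(** * Partitions finer than a given one *)

Section Factor.
Variable K : fieldType.

Lemma prod_blocks_in alpha beta D (E : {set 'I_n} -> K) :
  trivIset beta -> alpha \in NCon D -> D = cover beta ->
  (forall W, W \in beta -> blocks_in alpha W \in NCon W) ->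
  \prod_(W in beta) \prod_(V in blocks_in alpha W) E V = \prod_(V in alpha) E V.
Proof.
move=> tI aNC DE rNC; have /NConP[[sub ne cov _] _] := aNC.
under eq_bigr => W _ do under eq_bigl => V do rewrite inE.
rewrite (exchange_big_dep (mem alpha)) => [/=|W V _ /andP[]//].
apply: eq_bigr => V aV; have [x xV] := ne V aV.
have := subsetP (sub V aV) x xV; rewrite DE => /bigcupP[W bW xW].
rewrite (big_pred1 W) // => W' /=; rewrite aV /=.
apply/andP/eqP => [[bW' VW'] | ->].
  have xW' := subsetP VW' x xV.
  by rewrite -(def_pblock tI bW xW) (def_pblock tI bW' xW').
by split=> //; apply: blocks_in_stable aNC (rNC W bW) _ x aV xV xW.
Qed.

(** A partition finer than [beta] is an independent choice of a partition of each
block of [beta]. The choices assemble to a non-crossing partition because a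
crossing between pieces of different blocks would be a crossing in [beta]. That
each piece is in [A W], a family of partitions of [W], already forces the
refinement. *)
Theorem factorization beta (A : {set 'I_n} -> {set {set {set 'I_n}}})
    (F : {set 'I_n} -> {set {set 'I_n}} -> K) :
  trivIset beta -> noncrossing beta ->
  (forall W, W \in beta -> A W \subset NCon W) ->
  \sum_(alpha in NCon (cover beta) |
          [forall W in beta, blocks_in alpha W \in A W])
      \prod_(W in beta) F W (blocks_in alpha W) =
  \prod_(W in beta) \sum_(alpha in A W) F W alpha.
Proof.
move=> tI /noncrossingP nc /(_ _ _)/subsetP AN.
rewrite (big_distr_big_dep set0) /=.
(* The expanded product is a sum over the families of choices [h alpha]. *)
pose h alpha : {ffun {set 'I_n} -> {set {set 'I_n}}} :=
  [ffun W => if W \in beta then blocks_in alpha W else set0].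
pose h' (f : {ffun {set 'I_n} -> {set {set 'I_n}}}) := \bigcup_(W in beta) f W.
have same W W' x : W \in beta -> W' \in beta -> x \in W -> x \in W' -> W = W'.
  by move=> bW bW' xW xW'; rewrite -(def_pblock tI bW xW) (def_pblock tI bW' xW').
rewrite (reindex_onto h h') => [|f /pfamilyP[/subsetP sf fA]]; last first.
  apply/ffunP=> W; rewrite ffunE; case: ifP => [bW|]; last first.
    by move=> nbW; apply/esym/eqP; apply: contraFT nbW => fW; apply: sf.
  apply/setP=> V; rewrite inE; apply/andP/idP => [[/bigcupP[W' bW' VW'] VW]|VW].
    have /NConP[[sub ne _ _] _] := AN _ bW' _ (fA _ bW').
    have [x xV] := ne V VW'.
    by rewrite (same W W' x) ?(subsetP VW) ?(subsetP (sub V VW')).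
  have /NConP[[sub _ _ _] _] := AN _ bW _ (fA _ bW).
  by split; [apply/bigcupP; exists W | apply: sub].
apply: eq_big => [alpha | alpha _]; last first.
  by apply: eq_bigr => W bW; rewrite ffunE bW.
apply/andP/andP => [[aNC /forall_inP rA] | [/pfamilyP[_ hA] /eqP aE]].
  split.
    apply/pfamilyP; split=> [|W bW]; last by rewrite ffunE bW; apply: rA.
    by apply/subsetP => W; rewrite inE ffunE; case: ifP => //; rewrite eqxx.
  apply/eqP/setP=> V; apply/bigcupP/idP => [[W bW] | aV].
    by rewrite ffunE bW inE => /andP[].
  have /NConP[[sub ne _ _] _] := aNC; have [x xV] := ne V aV.
  have /bigcupP[W bW xW] := subsetP (sub V aV) x xV; exists W => //.
  rewrite ffunE bW inE aV /=.
  exact: blocks_in_stable aNC (AN _ bW _ (rA W bW)) _ x aV xV xW.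
have rA W : W \in beta -> blocks_in alpha W \in A W.
  by move=> bW; have := hA W bW; rewrite ffunE bW.
split; last by apply/forall_inP.
have aP V : V \in alpha -> exists2 W, W \in beta & V \in blocks_in alpha W.
  rewrite -{1}aE => /bigcupP[W bW]; rewrite ffunE bW => VW.
  by exists W.
have rP W : W \in beta -> blocks (blocks_in alpha W) W.
  by move=> bW; have /NConP[] := AN _ bW _ (rA W bW).
apply/NConP; split; first split=> [V /aP[W bW VW] | V /aP[W bW VW] | x | ].
- have [sub _ _ _] := rP W bW.
  by apply: subset_trans (sub V VW) _; apply: bigcup_sup.
- by have [_ ne _ _] := rP W bW; apply: ne VW.
- case/bigcupP=> W bW xW; have [_ _ cov _] := rP W bW.
  by have [V] := cov x xW; rewrite inE => /andP[aV _]; exists V.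
- move=> V V' x /aP[W bW VW] /aP[W' bW' VW'] xV xV'.
  have [sub _ _ tV] := rP W bW; have [sub' _ _ _] := rP W' bW'.
  have WW : W = W'.
    by apply: (same W W' x); rewrite ?(subsetP (sub V VW)) ?(subsetP (sub' V' VW')).
  by apply: (tV V V' x); rewrite // WW.
apply/noncrossingP=> V V' i j k l /aP[W bW VW] /aP[W' bW' VW'] ij jk kl iV kV jV lV.
have [sub _ _ _] := rP W bW; have [sub' _ _ _] := rP W' bW'.
have /subsetP sV := sub V VW; have /subsetP sV' := sub' V' VW'.
have WW : W = W'.
  by apply: (nc W W' i j k l) => //; [apply: sV | apply: sV | apply: sV' | apply: sV'].
have /NConP[_ /noncrossingP nW] := AN _ bW _ (rA W bW).
by apply: (nW V V' i j k l) => //; rewrite WW.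
Qed.

End Factor.
End Partitions.

(** * Removing the maximum of a closed partition *)

Section Rooted.
Variables (n : nat) (K : fieldType).
Implicit Types (V W D : {set 'I_n}) (alpha beta : {set {set 'I_n}}).
Implicit Types (i j k l m x y : 'I_n) (f g h : fps K).

Lemma is_minP i D : reflect (i \in D /\ forall x, x \in D -> (i <= x)%N) (is_min i D).
Proof. by apply: (iffP andP) => -[iD /forall_inP]. Qed.

Lemma is_maxP i D : reflect (i \in D /\ forall x, x \in D -> (x <= i)%N) (is_max i D).
Proof. by apply: (iffP andP) => -[iD /forall_inP]. Qed.

Lemma exists_min D : D != set0 -> exists i, is_min i D.
Proof.
case/set0Pn=> x xD; exists [arg min_(y < x in D) y]; apply/is_minP.
by case: arg_minnP.
Qed.

Lemma exists_max D : D != set0 -> exists i, is_max i D.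
Proof.
case/set0Pn=> x xD; exists [arg max_(y > x in D) y]; apply/is_maxP.
by case: arg_maxnP.
Qed.

Lemma is_min_inj i j D : is_min i D -> is_min j D -> i = j.
Proof.
case/is_minP=> iD imin /is_minP[jD jmin]; apply/val_inj/eqP.
by rewrite eqn_leq imin ?jmin.
Qed.

Lemma is_max_inj i j D : is_max i D -> is_max j D -> i = j.
Proof.
case/is_maxP=> iD imax /is_maxP[jD jmax]; apply/val_inj/eqP.
by rewrite eqn_leq imax ?jmax.
Qed.

Definition linked alpha i j := [exists V in alpha, (i \in V) && (j \in V)].

Lemma linkedP alpha i j :
  reflect (exists V, [/\ V \in alpha, i \in V & j \in V]) (linked alpha i j).
Proof.
by apply: (iffP exists_inP) => [[V aV /andP[]] | [V [aV iV jV]]]; exists V; rewrite ?iV.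
Qed.

(** The block of the root [i] has its own weight [h]; the recursion shifts [h]
while [f] is kept. *)
Definition rweight h f i alpha : K :=
  \prod_(V in alpha) (if i \in V then h #|V| else f #|V|).

Section Merge.
Variables (D : {set 'I_n}) (i m : 'I_n).
Hypotheses (imin : is_min i D) (mmax : is_max m D) (im : i != m).

Let add V := if i \in V then m |: V else V.

Lemma merge_NCon alpha : alpha \in NCon D -> linked alpha i m ->
  [set V :\ m | V in alpha] \in NCon (D :\ m).
Proof.
case/NConP=> [[sub ne cov tI] /noncrossingP nc] /linkedP[V0 [aV0 iV0 mV0]].
apply/NConP; split; first split.
- by move=> _ /imsetP[V aV ->]; apply/setSD/sub.
- move=> _ /imsetP[V aV ->]; have [x xV] := ne V aV.
  have [xm | xm] := eqVneq x m; last by exists x; rewrite !inE xm.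
  by exists i; rewrite !inE im (tI V V0 m) // -xm.
- move=> x; rewrite !inE => /andP[xm /cov[V aV xV]].
  by exists (V :\ m); [apply: imset_f | rewrite !inE xm].
- move=> _ _ x /imsetP[V aV ->] /imsetP[W aW ->].
  by rewrite !inE => /andP[_ xV] /andP[_ xW]; rewrite (tI V W x).
apply/noncrossingP=> _ _ a b c d /imsetP[V aV ->] /imsetP[W aW ->] ab bc cd.
rewrite !inE => /andP[_ aaV] /andP[_ cV] /andP[_ bW] /andP[_ dW].
by rewrite (nc V W a b c d).
Qed.

(** Adding [m] to the block of [i] creates no crossing: as [m] is the maximum,
it could only be the last point of one, and as [i] is the minimum, [i] followed
by the other three points would then cross already. *)
Lemma unmerge_NCon alpha : alpha \in NCon (D :\ m) -> add @: alpha \in NCon D.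
Proof.
case/NConP=> [[sub ne cov tI] /noncrossingP nc].
have [iD ile] := is_minP _ _ imin; have [mD lem] := is_maxP _ _ mmax.
have VD V x : V \in alpha -> x \in V -> (x != m) && (x \in D).
  by move=> aV xV; have := subsetP (sub V aV) x xV; rewrite !inE.
have addP V x : x \in add V -> x != m -> x \in V.
  by rewrite /add; case: ifP; rewrite // !inE => _ /orP[/eqP->|//]; rewrite eqxx.
have addm V : V \in alpha -> m \in add V -> i \in V.
  by rewrite /add => aV; case: ifP => // _ /(VD _ _ aV); rewrite eqxx.
have addD V x : V \in alpha -> x \in add V -> x \in D.
  move=> aV xV; have [-> // | xm] := eqVneq x m.
  by case/andP: (VD V x aV (addP _ _ xV xm)).
have addS V x : x \in V -> x \in add V.
  by rewrite /add; case: ifP; rewrite // !inE => _ ->; rewrite orbT.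
apply/NConP; split; first split.
- by move=> _ /imsetP[V aV ->]; apply/subsetP => x; apply: addD.
- by move=> _ /imsetP[V aV ->]; have [x xV] := ne V aV; exists x; apply: addS.
- move=> x xD; have [xm | xm] := eqVneq x m.
    have [|V aV iV] := cov i; first by rewrite !inE im.
    by exists (add V); [apply: imset_f | rewrite /add iV xm !inE eqxx].
  have [|V aV xV] := cov x; first by rewrite !inE xm.
  by exists (add V); [apply: imset_f | apply: addS].
- move=> _ _ x /imsetP[V aV ->] /imsetP[W aW ->] xV xW; congr add.
  have [xm | xm] := eqVneq x m; last by apply: (tI V W x) => //; apply: addP.
  by rewrite xm in xV xW; apply: (tI V W i) => //; apply: addm.
apply/noncrossingP=> _ _ a b c d /imsetP[V aV ->] /imsetP[W aW ->] ab bc cd.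
move=> aaV cV bW dW; congr add.
have dm := lem d (addD _ _ aW dW).
(* Only [d] can be the new point [m]. *)
have notm x : (x < d)%N -> x != m by apply: contraTneq => ->; rewrite -leqNgt.
have {}aaV := addP _ _ aaV (notm _ (ltn_trans (ltn_trans ab bc) cd)).
have {}bW := addP _ _ bW (notm _ (ltn_trans bc cd)).
have {}cV := addP _ _ cV (notm _ cd).
have [dEm | {}dm] := eqVneq d m; last by apply: (nc V W a b c d) => //; apply: addP.
rewrite dEm in dW; have iW := addm W aW dW.
have [iV | niV] := boolP (i \in V); first exact: (tI V W i).
have ia : (i < a)%N.
  rewrite ltn_neqAle ile ?andbT; last by case/andP: (VD V a aV aaV).
  by apply: contraNneq niV => /val_inj->.
by apply/esym; apply: (nc W V i a b c).
Qed.

(** Removing [m] is a bijection from the partitions that join the minimum [i] to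
the maximum [m] to all the partitions of the other points. It makes the block of
[i] one element smaller, hence the shift of [h]. *)
Lemma merge_extremes h f :
  \sum_(alpha in NCon D | linked alpha i m) rweight h f i alpha =
  \sum_(alpha in NCon (D :\ m)) rweight (fps_divX h) f i alpha.
Proof.
have addK alpha : alpha \in NCon (D :\ m) -> forall V, V \in alpha ->
    m \notin V /\ add V :\ m = V.
  case/NConP=> [[sub ne cov tI] _] V aV.
  have mV : m \notin V.
    by apply: contraTN isT => /(subsetP (sub V aV)); rewrite !inE eqxx.
  split=> //; rewrite /add; case: ifP => _; first exact: setU1K.
  by apply/setDidPl; rewrite disjoint_sym disjoints1.
rewrite (reindex_onto (fun alpha => add @: alpha)
                      (fun alpha => [set V :\ m | V in alpha])) /=; last first.
  move=> alpha /andP[/NConP[[sub ne cov tI] _] /linkedP[V0 [aV0 iV0 mV0]]].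
  rewrite -imset_comp -[RHS]imset_id; apply: eq_in_imset => V aV /=.
  rewrite /add !inE im /=; case: ifP => [iV | niV].
    by rewrite setD1K // (tI V V0 i).
  apply/setDidPl; rewrite disjoint_sym disjoints1.
  by apply: contraFN niV => mV; rewrite (tI V V0 m).
apply: eq_big => [alpha | alpha /andP[/andP[aNC al] /eqP aE]]; last first.
  have {}aNC : alpha \in NCon (D :\ m) by rewrite -aE merge_NCon.
  rewrite /rweight big_imset /=; last first.
    by move=> V W /(addK _ aNC)[_ {2}<-] /(addK _ aNC)[_ {2}<-] ->.
  apply: eq_bigr => V aV; have [mV _] := addK _ aNC V aV.
  rewrite /add; have [iV | /negPf niV] := boolP (i \in V); last by rewrite niV.
  by rewrite !inE iV orbT cardsU1 mV.
apply/andP/idP => [[/andP[aNC al] /eqP aE] | aNC].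
  by rewrite -aE merge_NCon.
rewrite unmerge_NCon //; split.
  have /NConP[[_ _ cov _] _] := aNC.
  have [|V aV iV] := cov i; first by rewrite !inE im; case/andP: imin.
  apply/linkedP; exists (add V).
  by rewrite imset_f // /add iV !inE eqxx iV orbT.
rewrite -imset_comp -[X in _ == X]imset_id; apply/eqP/eq_in_imset => V aV /=.
by case: (addK _ aNC V aV).
Qed.

End Merge.

Lemma blocks_set1 alpha i : blocks alpha [set i] -> alpha = [set [set i]].
Proof.
case=> sub ne cov tI.
have E V : V \in alpha -> V = [set i].
  move=> aV; have := sub V aV; rewrite subset1 => /orP[/eqP // | /eqP V0].
  by have [x] := ne V aV; rewrite V0 inE.
apply/setP=> V; rewrite inE; apply/idP/eqP => [/E // | ->].
by have [|W aW _] := cov i; rewrite ?inE // -(E W).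
Qed.

Lemma NCon_set1 i : NCon [set i] = [set [set [set i]]].
Proof.
apply/setP=> alpha; rewrite [RHS]inE.
apply/NConP/eqP => [[/blocks_set1] // | ->]; split.
  split=> [V | V | x | V W x].
  - by rewrite inE => /eqP->; rewrite subxx.
  - by rewrite inE => /eqP->; exists i; rewrite inE.
  - by move=> xi; exists [set i]; rewrite ?set11.
  by rewrite !inE => /eqP-> /eqP->.
by apply/noncrossingP => V W a b c d; rewrite !inE => /eqP-> /eqP->.
Qed.

Lemma NCon_set0 : NCon (set0 : {set 'I_n}) = [set set0].
Proof.
apply/setP=> alpha; rewrite [LHS]inE partition_set0 inE.
case: eqP => //= ->; apply/noncrossingP => V W a b c d.
by rewrite inE.
Qed.

(** The sum over the partitions joining both extremes, from the sums over
partitions with one point fewer. When [D] is a singleton the only weight is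
[h 1], the constant term of [divX h], so that the formula has no exception. *)
Lemma closed_sum D i m h f u :
  is_min i D -> is_max m D ->
  (forall h', is_min i (D :\ m) ->
     \sum_(alpha in NCon (D :\ m)) rweight h' f i alpha =
     fps_comp h' u #|D :\ m|) ->
  \sum_(alpha in NCon D | linked alpha i m) rweight h f i alpha =
  fps_comp (fps_divX h) u #|D|.-1.
Proof.
move=> imin mmax IH; have [iD ile] := is_minP _ _ imin.
have [mD lem] := is_maxP _ _ mmax; rewrite (cardsD1 m) mD /=.
have [im | im] := eqVneq i m.
  have DE : D = [set i].
    apply/setP=> x; rewrite inE; apply/idP/eqP => [xD | -> //].
    by apply/val_inj/eqP; rewrite eqn_leq ile // andbT {1}im lem.
  rewrite DE im setDv cards0 fps_comp0 NCon_set1.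
  rewrite (big_pred1 [set [set m]]) => [|alpha]; last first.
    rewrite /= inE; case: eqP => //= ->; apply/linkedP.
    by exists [set m]; rewrite !inE.
  by rewrite /rweight big_set1 inE eqxx cards1.
rewrite merge_extremes // IH //; apply/is_minP.
by rewrite !inE im; split=> // x; rewrite !inE => /andP[_ /ile].
Qed.

End Rooted.

(** * Solution of the functional equation *)

Section Main.
Variables (n : nat) (K : fieldType).
Implicit Types (V W D : {set 'I_n}) (alpha beta : {set {set 'I_n}}).
Implicit Types (i j k l m x y : 'I_n) (f g h : fps K).

(** Removing the maximum of [D] leaves the ranks of the other elements unchanged. *)
Lemma sum_rank D (F : nat -> K) :
  \sum_(m in D) F #|[set x in D | (x < m)%N]| = \sum_(k < #|D|) F k.
Proof.
move En: #|D| => N; elim: N D En => [|N IHN] D cD.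
  by rewrite big_ord0 (cards0_eq cD) big_set0.
have [|m mmax] := @exists_max n D; first by rewrite -card_gt0 cD.
have [mD lem] := is_maxP _ _ mmax.
have cDm : #|D :\ m| = N by have := cardsD1 m D; rewrite mD cD => -[].
rewrite (big_setD1 m) //= big_ord_recr /= addrC -(IHN _ cDm); congr (_ + F _).
  apply: eq_bigr => k; rewrite !inE => /andP[km kD]; congr (F _).
  apply: eq_card => x; rewrite !inE; have [-> /= | //] := eqVneq x m.
  by rewrite ltnNge lem ?andbF.
rewrite -cDm; apply: eq_card => x; rewrite !inE andbC ltn_neqAle.
by case xD: (x \in D); rewrite ?andbF // lem // !andbT.
Qed.

Definition first_block_max alpha i m :=
  [exists V in alpha, (i \in V) && is_max m V].

Lemma first_block_maxP alpha i m :
  reflect (exists V, [/\ V \in alpha, i \in V & is_max m V])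
          (first_block_max alpha i m).
Proof.
by apply: (iffP exists_inP) => [[V aV /andP[]] | [V [aV iV mV]]]; exists V; rewrite ?iV.
Qed.

Lemma sum_first_block_max D i (F : {set {set 'I_n}} -> K) : i \in D ->
  \sum_(alpha in NCon D) F alpha =
  \sum_(m in D) \sum_(alpha in NCon D | first_block_max alpha i m) F alpha.
Proof.
move=> iD; rewrite (exchange_big_dep (mem (NCon D))) => /= [|m alpha _ /andP[]//].
apply: eq_bigr => alpha aNC; have /NConP[[sub ne cov tI] _] := aNC.
have [V0 aV0 iV0] := cov i iD.
have [|m mmax] := @exists_max n V0; first by apply/set0Pn; exists i.
rewrite (big_pred1 m) // => m'; rewrite /= aNC /=.
apply/andP/eqP => [[_ /first_block_maxP[V [aV iV]]] | ->].
  by rewrite (tI V V0 i) // => /is_max_inj; apply.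
split; first by case/is_maxP: mmax => /(subsetP (sub V0 aV0)).
by apply/first_block_maxP; exists V0.
Qed.

(** The block of [i = min D] has [i] and [m] as its extremes, so any other block
having points on both sides of [m] would cross it. The partition thus
splits into one of the points up to [m], joining [i] and [m], and one of the
points after [m], whose blocks do not contain the root. *)
Lemma split_at_first_block_max D i m h f : is_min i D -> m \in D ->
  \sum_(alpha in NCon D | first_block_max alpha i m) rweight h f i alpha =
  (\sum_(alpha in NCon [set x in D | (x <= m)%N] | linked alpha i m)
     rweight h f i alpha) *
  (\sum_(alpha in NCon [set x in D | (m < x)%N]) \prod_(V in alpha) f #|V|).
Proof.
move=> imin mD; have [iD ile] := is_minP _ _ imin.
set L := [set x in D | (x <= m)%N]; set H := [set x in D | (m < x)%N].
have iL : i \in L by rewrite inE iD ile.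
have mL : m \in L by rewrite inE mD leqnn.
have niH : i \notin H by rewrite inE iD ltnNge ile.
have LH : L != H by apply: contraNneq niH => <-.
have LHdisj x : x \in L -> x \notin H.
  by rewrite !inE => /andP[-> xm]; rewrite -leqNgt.
have DE : D = cover [set L; H].
  rewrite /cover big_setU1 ?inE //= big_set1; apply/setP=> x; rewrite !inE.
  by case: ltnP; rewrite ?andbF ?andbT ?orbF.
have tI : trivIset [set L; H].
  apply/trivIsetP=> V W /set2P[]-> /set2P[]->; rewrite ?eqxx // => _.
    by apply/pred0P=> x; apply/negP=> /andP[/LHdisj/negP].
  by apply/pred0P=> x; apply/negP=> /andP[/[swap]/LHdisj/negP].
have nc : noncrossing [set L; H].
  apply/noncrossingP=> V W a b c d /set2P[]-> /set2P[]-> // ab bc _.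
    rewrite !inE => _ /andP[_ cm] /andP[_ /(leq_trans)/(_ (ltnW bc))].
    by rewrite ltnNge cm.
  move=> + _ + _; rewrite !inE => /andP[_ am] /andP[_ bm].
  by have := leq_trans am (ltnW ab); rewrite ltnNge bm.
pose A W := [set alpha in NCon W | (i \in W) ==> linked alpha i m].
have AN W : W \in [set L; H] -> A W \subset NCon W.
  by move=> _; apply/subsetP=> alpha; rewrite inE => /andP[].
have := factorization (fun W => rweight h f i) tI nc AN.
rewrite [RHS]big_setU1 ?inE //= big_set1 -DE => factor.
transitivity (\sum_(alpha in NCon D | [forall W in [set L; H], blocks_in alpha W \in A W])
      \prod_(W in [set L; H]) rweight h f i (blocks_in alpha W)); last first.
  rewrite {}factor; congr (_ * _).
    by apply: eq_bigl => alpha; rewrite inE iL.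
  apply: eq_big => [alpha | alpha]; first by rewrite inE (negPf niH) andbT.
  rewrite inE => /andP[/NConP[[sub _ _ _] _] _]; apply: eq_bigr => V aV.
  by case: ifP => // /(subsetP (sub V aV)); rewrite (negPf niH).
have fwd alpha : alpha \in NCon D -> first_block_max alpha i m ->
    forall W, W \in [set L; H] -> blocks_in alpha W \in A W.
  move=> aNC /first_block_maxP[V0 [aV0 iV0 /is_maxP[mV0 lem]]] W.
  have /NConP[[sub _ _ tV] /noncrossingP ncV] := aNC.
  have stable V x y : V \in alpha -> x \in V -> y \in V ->
      (x <= m)%N -> (y <= m)%N.
    move=> aV xV yV xm; rewrite leqNgt; apply/negP => my.
    have VV0 : V0 != V by apply: contraTneq my => V0V; rewrite -leqNgt lem ?V0V.
    apply: (elimN eqP VV0); apply: (ncV V0 V i x m y) => //.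
      rewrite ltn_neqAle ile ?(subsetP (sub V aV)) // andbT.
      by apply: contra_neq VV0 => /val_inj ix; apply: (tV V0 V i); rewrite // ix.
    rewrite ltn_neqAle xm andbT.
    by apply: contra_neq VV0 => /val_inj xE; apply: (tV V0 V x); rewrite // xE.
  have VD V x : V \in alpha -> x \in V -> x \in D.
    by move=> aV; apply/subsetP/sub.
  case/set2P=> ->; rewrite inE; apply/andP; split.
  - apply: blocks_in_NCon aNC _ _; first by apply/subsetP=> x; rewrite inE => /andP[].
    move=> V x y aV xV yV; rewrite !inE => /andP[_ xm].
    by rewrite (VD V) // (stable V x).
  - apply/implyP=> _; apply/linkedP; exists V0; split=> //.
    rewrite inE aV0; apply/subsetP=> x xV0.
    by rewrite inE (VD V0) ?lem.
  - apply: blocks_in_NCon aNC _ _; first by apply/subsetP=> x; rewrite inE => /andP[].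
    move=> V x y aV xV yV; rewrite !inE !ltnNge => /andP[_ xm].
    by rewrite (VD V) //; apply: contra xm; apply: (stable V y).
  by rewrite (negPf niH).
apply: eq_big => [alpha | alpha /andP[aNC am]]; last first.
  rewrite /rweight (prod_blocks_in _ tI aNC DE) // => W LHW.
  exact: subsetP (AN W LHW) _ (fwd alpha aNC am W LHW).
apply: andb_id2l => aNC; apply/idP/forall_inP => [am | rA]; first exact: fwd.
have := rA L (set21 _ _); rewrite inE iL => /andP[_ /linkedP[V []]].
rewrite inE => /andP[aV /subsetP VL] iV mV.
apply/first_block_maxP; exists V; split=> //; apply/is_maxP; split=> // x /VL.
by rewrite inE => /andP[].
Qed.

(** By induction on the number of points. Summing over the maximum [m] of the
first block, with [r] points before it, gives the sum over [r] of the products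
of the coefficient of degree [r] of [divX h o (z g)], for the closed part, by
[g (#|D| - 1 - r)], for the points after [m]. This is the recursion
[fps_compXmulS]. The case [h = f] provides the values of [g] that the induction
uses. *)
Theorem noncrossing_functional_equation f g : f 0%N = 1 ->
  g = fps_comp f (fps_mul (fps_X K) g) ->
  forall D h i, is_min i D ->
  \sum_(alpha in NCon D) rweight h f i alpha =
  fps_comp h (fps_mul (fps_X K) g) #|D|.
Proof.
move=> f0 gE D; move cD: #|D| => N; elim/ltn_ind: N D cD => N IHN D cD h i imin.
have IH D' : (#|D'| < N)%N -> forall h i, is_min i D' ->
  \sum_(alpha in NCon D') rweight h f i alpha = fps_comp h (fps_mul (fps_X K) g) #|D'|.
  by move=> ltD'; apply: IHN ltD' D' erefl.
have gsum D' : (#|D'| < N)%N ->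
    \sum_(alpha in NCon D') \prod_(V in alpha) f #|V| = g #|D'|.
  move=> ltD'; have [D0 | /exists_min[j jmin]] := eqVneq D' set0.
    rewrite D0 cards0 NCon_set0 big_set1 big_set0.
    by rewrite gE fps_comp0.
  rewrite [in RHS]gE -(IH D' ltD' f j jmin).
  by apply: eq_bigr => alpha _; apply: eq_bigr => V _; rewrite if_same.
have [iD ile] := is_minP _ _ imin.
rewrite (sum_first_block_max _ iD).
pose F (r : nat) := fps_comp (fps_divX h) (fps_mul (fps_X K) g) r * g (N.-1 - r)%N.
transitivity (\sum_(m in D) F #|[set x in D | (x < m)%N]|); last first.
  rewrite sum_rank cD {}/F; case: N {IHN IH gsum} cD => [/cards0_eq D0|N _].
    by rewrite D0 inE in iD.
  by rewrite fps_compXmulS.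
apply: eq_bigr => m mD; rewrite split_at_first_block_max //.
set L := [set x in D | (x <= m)%N]; set H := [set x in D | (m < x)%N].
set L' := [set x in D | (x < m)%N].
have mL : m \in L by rewrite inE mD leqnn.
have LE : L :\ m = L'.
  by apply/setP=> x; rewrite !inE [in RHS]ltn_neqAle andbCA.
have cL : #|L| = #|L'|.+1 by rewrite (cardsD1 m) mL LE.
have cDE : N = (#|L| + #|H|)%N.
  rewrite -cD -cardsUI [L :&: H](_ : _ = set0) ?cards0 ?addn0.
    by apply: eq_card => x; rewrite !inE; case: ltnP; rewrite ?andbT ?andbF ?orbF.
  by apply/setP=> x; rewrite !inE; case: ltnP; rewrite ?andbF.
have mmax : is_max m L.
  by apply/is_maxP; split=> // x; rewrite inE => /andP[].
have iL : is_min i L.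
  apply/is_minP; split; first by rewrite inE iD ile.
  by move=> x; rewrite inE => /andP[/ile].
rewrite (closed_sum _ (u := fps_mul (fps_X K) g) iL mmax) => [|h']; last first.
  by rewrite LE; apply: IH; rewrite cDE cL addSn ltnS leq_addr.
rewrite cL gsum; last by rewrite cDE cL addSn ltnS leq_addl.
by rewrite /F cDE cL addSn /= addKn.
Qed.

Corollary sum_NCon f g : f 0%N = 1 ->
  g = fps_comp f (fps_mul (fps_X K) g) ->
  forall D, \sum_(alpha in NCon D) \prod_(V in alpha) f #|V| = g #|D|.
Proof.
move=> f0 gE D; have [D0 | /exists_min[i imin]] := eqVneq D set0.
  by rewrite D0 cards0 NCon_set0 big_set1 big_set0 gE fps_comp0.
rewrite [in RHS]gE -(noncrossing_functional_equation f0 gE f imin).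
by apply: eq_bigr => alpha _; apply: eq_bigr => V _; rewrite if_same.
Qed.

(** * Pairs of non-crossing partitions *)

Section Pairs.

(** When [W] is a block of [beta], these are the possible pieces inside [W] of an
[alpha] with [ll alpha beta], by [llE]. *)
Definition closed W :=
  [set alpha in NCon W |
    [exists i, exists j, [&& is_min i W, is_max j W & linked alpha i j]]].

Lemma closedE W i j : is_min i W -> is_max j W ->
  forall alpha, (alpha \in closed W) = (alpha \in NCon W) && linked alpha i j.
Proof.
move=> imin jmax alpha; rewrite inE; congr (_ && _).
apply/idP/idP => [/existsP[i' /existsP[j' /and3P[i'min j'max]]] | ij].
  by rewrite (is_min_inj i'min imin) (is_max_inj j'max jmax).
by apply/existsP; exists i; apply/existsP; exists j; rewrite imin jmax.
Qed.

Lemma llE alpha beta : alpha \in NC n -> beta \in NC n ->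
  ll alpha beta = [forall W in beta, blocks_in alpha W \in closed W].
Proof.
rewrite -!NCon_setT => aNC bNC.
have /NConP[[_ ne cov tI] nc] := aNC; have /NConP[[_ neb _ _] _] := bNC.
apply/andP/forall_inP => [[/forall_inP ref /forall_inP llE] W bW | rA].
  have rNC : blocks_in alpha W \in NCon W.
    apply: blocks_in_NCon aNC (subsetT W) _ => V x y aV xV yV.
    have /existsP[S /andP[/subsetP Sa /eqP->]] := ref W bW.
    case/bigcupP=> V' SV' xV'; apply/bigcupP; exists V' => //.
    by rewrite (tI V' V x (Sa _ SV') aV xV' xV).
  have /exists_inP[V aV /existsP[i /existsP[j]]] := llE W bW.
  case/and4P=> imin jmax iV jV; rewrite (closedE imin jmax) rNC.
  apply/linkedP; exists V; split=> //; rewrite inE aV /=.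
  by have [iW _] := is_minP _ _ imin; apply: blocks_in_stable aNC rNC _ i aV iV iW.
split; apply/forall_inP => W /rA.
  rewrite inE => /andP[/NConP[/blocksP/cover_partition cW _] _].
  apply/existsP; exists (blocks_in alpha W); rewrite cW eqxx andbT.
  by apply/subsetP=> V; rewrite inE => /andP[].
rewrite inE => /andP[_ /existsP[i /existsP[j]]] /and3P[imin jmax].
case/linkedP=> V []; rewrite inE => /andP[aV _] iV jV.
apply/exists_inP; exists V => //; apply/existsP; exists i; apply/existsP; exists j.
by rewrite imin jmax iV.
Qed.

(** A block of [beta] that shares its minimum with [V] contains a point of [W],
so it is [W]. The blocks of [alpha] that share the extremes of [W] are then
those containing its minimum, as [alpha] joins both extremes. *)
Lemma special_closed beta W i j alpha V :
  beta \in NC n -> W \in beta -> is_min i W -> is_max j W ->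
  alpha \in closed W -> V \in alpha -> special beta V = (i \in V).
Proof.
rewrite -NCon_setT => /NConP[[_ _ _ tI] _] bW imin jmax.
rewrite (closedE imin jmax) => /andP[/NConP[[sub _ _ tV] _]].
case/linkedP=> V0 [aV0 iV0 jV0] aV; have /subsetP VW := sub V aV.
apply/exists_inP/idP => [[W' bW' /andP[/existsP[k /andP[kV kW'] _]]] | iV].
  have [kV' _] := is_minP _ _ kV; have [kiW' _] := is_minP _ _ kW'.
  rewrite (tI W' W k) ?VW // in kW'.
  by rewrite -(is_min_inj kW' imin).
have jV : j \in V by rewrite (tV V V0 i).
have [_ ile] := is_minP _ _ imin; have [_ lej] := is_maxP _ _ jmax.
exists W => //; apply/andP; split; apply/existsP.
  by exists i; rewrite imin andbT; apply/is_minP; split=> // x /VW/ile.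
by exists j; rewrite jmax andbT; apply/is_maxP; split=> // x /VW/lej.
Qed.

(** The root weight [k |-> t (k - 1)] is the shift of [t], so removing the maximum
of [W] leaves the weight [t] on every block. *)
Lemma sum_closed beta W t c : beta \in NC n -> W \in beta -> t 0%N = 1 ->
  fps_divX c = fps_comp t (fps_mul (fps_X K) (fps_divX c)) ->
  \sum_(alpha in closed W)
    \prod_(V in alpha) (if special beta V then t (#|V| - 1)%N else t #|V|) =
  c #|W|.
Proof.
move=> bNC bW t0 cE; have /NConP[[_ /(_ W bW)[x xW] _ _] _] := bNC.
have W0 : W != set0 by apply/set0Pn; exists x.
have [i imin] := exists_min W0; have [j jmax] := exists_max W0.
pose h : fps K := fun k : nat => t (k - 1)%N.
have ht : fps_divX h = t by apply: funext => k; rewrite /fps_divX /h subn1.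
transitivity (\sum_(alpha in NCon W | linked alpha i j) rweight h t i alpha).
  apply: eq_big => [alpha | alpha aA]; first exact: closedE.
  by apply: eq_bigr => V aV; rewrite (special_closed bNC bW imin jmax aA aV).
rewrite (closed_sum h imin jmax (u := fps_mul (fps_X K) (fps_divX c))); last first.
  by move=> h'; apply: noncrossing_functional_equation.
by rewrite ht -cE /fps_divX prednK // card_gt0.
Qed.

Lemma sum_ll beta t c : beta \in NC n -> t 0%N = 1 ->
  fps_divX c = fps_comp t (fps_mul (fps_X K) (fps_divX c)) ->
  \sum_(alpha in NC n | ll alpha beta)
    \prod_(V in alpha) (if special beta V then t (#|V| - 1)%N else t #|V|) =
  \prod_(W in beta) c #|W|.
Proof.
move=> bNC t0 cE; pose E V := if special beta V then t (#|V| - 1)%N else t #|V|.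
have AN W : W \in beta -> closed W \subset NCon W.
  by move=> _; apply/subsetP=> alpha; rewrite inE => /andP[].
have := bNC; rewrite inE => /andP[/and3P[/eqP cb tI _] nc].
transitivity (\sum_(alpha in NCon (cover beta) |
      [forall W in beta, blocks_in alpha W \in closed W])
    \prod_(W in beta) \prod_(V in blocks_in alpha W) E V).
  rewrite cb NCon_setT.
  apply: eq_big => [alpha | alpha /andP[aNC]].
    by apply: andb_id2l => aNC; apply: llE.
  rewrite llE // => /forall_inP rA; apply/esym.
  apply: (prod_blocks_in _ tI _ erefl); first by rewrite cb.
  by move=> W bW; apply: subsetP (AN W bW) _ (rA W bW).
rewrite (factorization (fun W alpha => \prod_(V in alpha) E V) tI nc AN).
by apply: eq_bigr => W bW; apply: sum_closed.
Qed.

End Pairs.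
End Main.

Local Open Scope complex_scope.

Theorem proposition4p3 (R : realType) (A : algType R[i]) (phi : {scalar A})
  (phi1 : phi 1 = 1) (a : A) (phia : phi a = 1) (n : nat) (n_ge1 : (1 <= n)%N) :
  let t := fps_inv (S_transform phi a) in
  phi (a ^+ n) =
    \sum_(alpha in NC n) \sum_(beta in NC n | ll alpha beta)
      (\prod_(U in alpha | special beta U) t (#|U| - 1)%N) *
      (\prod_(V in alpha | ~~ special beta V) t #|V|).
Proof.
move=> t; rewrite (exchange_big_dep (mem (NC n))) => /= [|alpha beta _ /andP[]//].
have t0 : t 0%N = 1 by apply: inv_S_transform0.
set C := R_transform phi a; have C0 : C 0%N = 0 by apply: R_transform0.
transitivity (\sum_(beta in NC n) \prod_(W in beta) fps_add (fps_one _) C #|W|).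
  (* Changing the constant term of [C] to [1], which [sum_NCon] asks for,
     keeps the weights because no block is empty. *)
  have C1 : fps_add (fps_one _) C 0%N = 1.
    by rewrite /fps_add /fps_one eqxx C0 addr0.
  rewrite -NCon_setT (sum_NCon C1 (moment_cumulant phia)) cardsT card_ord.
  by case: n n_ge1 => // n' _; rewrite /fps_add /fps_one /= add0r.
apply: eq_bigr => beta bNC.
transitivity (\prod_(W in beta) C #|W|).
  apply: eq_bigr => W bW; have /NConP[[_ /(_ W bW)[x xW] _ _] _] := bNC.
  by rewrite /fps_add /fps_one (cardsD1 x) xW add0r.
rewrite -(sum_ll bNC t0 (R_transform_fixpoint phia)).
apply: eq_big => [alpha | alpha _]; first by rewrite bNC.
rewrite (bigID (special beta)) /=; congr (_ * _).
  by apply: eq_bigr => V /andP[_ ->].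
by apply: eq_bigr => V /andP[_ /negPf->].
Qed.
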